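(* Let $d=2$ and let $k_0,\nu,\omega,\chi,a,b$ and the sets $\Sigma_1,\Sigma_2,\mathcal Y_1,\mathcal Y_2$ be as in the context. Define $$\tilde{\mathcal Y}=\{\eta-H_\nu\sigma\mid \eta\in(-\Sigma_1)\cap S_{e_2},\ \sigma\in\Sigma_2\cap S_{-e_2},\ H_\nu\sigma\notin S_{-e_2}\}.$$ (i) For every solution $g:\mathbb R^2\to\mathbb C$ of the homogeneous system (HS), one has $g=0$ almost everywhere on $\mathcal Y_1\cup\tilde{\mathcal Y}$. (ii) Conversely, for almost every $y\in\mathcal Y_2\setminus(\mathcal Y_1\cup\tilde{\mathcal Y})$ there exists a solution $g:\mathbb R^2\to\mathbb C$ of (HS) with $g(y)\neq0$.
   Context: ''Almost every(where)'' refers to Lebesgue measure on $\mathbb R^2$. Solutions $g$ are arbitrary functions (no regularity is required). Setting ($d=2$): $k_0>0$; $\nu,\omega\in\mathbb R^2$ are unit vectors; $\langle\cdot,\cdot\rangle$ is the Euclidean inner product; $\mathbb S^{1}_{k_0}=\{x\in\mathbb R^2\mid\|x\|=k_0\}$; $e_2=(0,1)$. For $v\in\mathbb R^2\setminus\{0\}$ put $S_v=\{s\in\mathbb S^{1}_{k_0}\mid\langle s,v\rangle>0\}$. $H_\nu x=x-2\langle x,\nu\rangle\nu$. $\Sigma_1=\{\sigma\in S_\omega\mid H_\nu\sigma\notin S_\omega\}$, $\Sigma_2=\{\sigma\in S_\omega\mid H_\nu\sigma\in S_\omega\}$; $-\Sigma_j=\{-\sigma\mid\sigma\in\Sigma_j\}$.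 $\mathcal Y_j=\{\eta-\sigma\mid\eta\in S_{e_2},\ \sigma\in\Sigma_j\}$ for $j=1,2$. Let $a:\mathbb S^1_{k_0}\to\mathbb C$ be a square-integrable function with $a(s)\ne0$ if and only if $\langle s,\omega\rangle>0$. Fix $\chi\in(0,1)$, let $\Sigma_{2,\chi}=\{\tilde\chi\sigma\mid\sigma\in\Sigma_2,\ \tilde\chi\in(1-\chi,1+\chi)\}$, and define $b:\Sigma_{2,\chi}\to\mathbb C\setminus\{0\}$ by $b(\tilde\chi\sigma)=a(\sigma)/a(H_\nu\sigma)$ for $\sigma\in\Sigma_2$, $\tilde\chi\in(1-\chi,1+\chi)$. Homogeneous system (HS) for $g:\mathbb R^2\to\mathbb C$: for all $\eta\in S_{e_2}$, $g(\eta-\sigma)=0$ for every $\sigma\in\Sigma_1$, and $b(\sigma)g(\eta-\sigma)+g(\eta-H_\nu\sigma)=0$ for every $\sigma\in\Sigma_2$. *)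

(* Defs.v *)
From mathcomp Require Import all_boot all_order all_algebra.
From mathcomp Require Import complex.
From mathcomp Require Import all_classical all_reals all_analysis.

Set Implicit Arguments.
Unset Strict Implicit.
Unset Printing Implicit Defensive.

Import Order.TTheory GRing.Theory Num.Theory.
Import numFieldNormedType.Exports.

Local Open Scope classical_set_scope.
Local Open Scope ring_scope.

Definition lebesgue_plane (R : realType) :
    {measure set (measurableTypeR R * measurableTypeR R) -> \bar R} :=
  (@lebesgue_measure R \x @lebesgue_measure R)%E.

Definition dot (R : realType) (x y : R * R) : R := x.1 * y.1 + x.2 * y.2.

(* The library norm `|x| on R * R is the max-norm, hence this definition. *)
Definition enorm (R : realType) (x : R * R) : R := Num.sqrt (dot x x).

Definition e2 (R : realType) : R * R := (0, 1).

Definition circle (R : realType) (k0 : R) : set (R * R) :=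
  [set x | enorm x = k0].

(* S_v *)
Definition halfcircle (R : realType) (k0 : R) (v : R * R) : set (R * R) :=
  [set s | circle k0 s /\ 0 < dot s v].

(* H_nu *)
Definition mirror (R : realType) (nu x : R * R) : R * R :=
  x - (2 * dot x nu) *: nu.

Definition Sigma1 (R : realType) (k0 : R) (nu omega : R * R) : set (R * R) :=
  [set s | halfcircle k0 omega s /\ ~ halfcircle k0 omega (mirror nu s)].

Definition Sigma2 (R : realType) (k0 : R) (nu omega : R * R) : set (R * R) :=
  [set s | halfcircle k0 omega s /\ halfcircle k0 omega (mirror nu s)].

Definition Y1 (R : realType) (k0 : R) (nu omega : R * R) : set (R * R) :=
  [set eta - s | eta in halfcircle k0 (e2 R) & s in Sigma1 k0 nu omega].

Definition Y2 (R : realType) (k0 : R) (nu omega : R * R) : set (R * R) :=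
  [set eta - s | eta in halfcircle k0 (e2 R) & s in Sigma2 k0 nu omega].

Definition Ytilde (R : realType) (k0 : R) (nu omega : R * R) : set (R * R) :=
  [set eta - mirror nu s |
     eta in [set - s' | s' in Sigma1 k0 nu omega] `&` halfcircle k0 (e2 R) &
     s in Sigma2 k0 nu omega `&` halfcircle k0 (- e2 R) `&`
          [set s | ~ halfcircle k0 (- e2 R) (mirror nu s)]].

(* L^2 with respect to arc length, through the parametrization
   t |-> (k0 cos t, k0 sin t), whose speed is the factor k0. Measurability is
   that of the Lebesgue (completed) sigma-algebra. Only the restriction of [a]
   to the circle is involved. *)
Definition square_integrable_circle (R : realType) (k0 : R)
    (a : R * R -> R[i]) : Prop :=
  let at_angle := fun t : caratheodory_type (wlength (@idfun R))^*%mu =>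
    a (k0 * cos t, k0 * sin t) in
  let D : set (caratheodory_type (wlength (@idfun R))^*%mu) :=
    [set` `[0, 2 * pi]] in
  [/\ measurable_fun D (fun t => complex.Re (at_angle t) : measurableTypeR R),
      measurable_fun D (fun t => complex.Im (at_angle t) : measurableTypeR R) &
      (\int[completed_lebesgue_measure]_(t in D)
         ((complex.Re (at_angle t) ^+ 2 + complex.Im (at_angle t) ^+ 2) * k0)%:E
       < +oo)%E].

Definition Sigma2chi (R : realType) (k0 chi : R) (nu omega : R * R) :
    set (R * R) :=
  [set t *: s | t in [set` `]1 - chi, 1 + chi[] & s in Sigma2 k0 nu omega].

(* [b], restricted to Sigma2chi, is the function Sigma2chi -> C \ {0} of the
   problem; its values elsewhere are unconstrained (and never used). *)
Definition is_ratio (R : realType) (k0 chi : R) (nu omega : R * R)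
    (a b : R * R -> R[i]) : Prop :=
  (forall x, Sigma2chi k0 chi nu omega x -> b x <> 0) /\
  (forall t s, 1 - chi < t < 1 + chi -> Sigma2 k0 nu omega s ->
     b (t *: s) = a s / a (mirror nu s)).

Definition solves_HS (R : realType) (k0 : R) (nu omega : R * R)
    (b g : R * R -> R[i]) : Prop :=
  forall eta, halfcircle k0 (e2 R) eta ->
    (forall s, Sigma1 k0 nu omega s -> g (eta - s) = 0) /\
    (forall s, Sigma2 k0 nu omega s ->
       b s * g (eta - s) + g (eta - mirror nu s) = 0).

(* Main.v *)
(* A nonzero y = p + q with p, q on the circle determines the unordered pair
   {p, q}, so (HS) is a system on unordered pairs of points of the circle, with
   equations linking {p, q} to {p, H q} when p lies in the upper half circle and
   -q in Sigma_2. Hence the equations reach at most the four pairs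
   {p or H p, q or H q}.
   Part (i): on Y1 the equations read g = 0, and a point of Ytilde is linked to
   a point of Y1; the conclusion even holds everywhere.
   Part (ii): up to sign g {p, q} = 1 / (a(-p) a(-q)), the sign changing with
   each reflection, solves the equations, with 1 / a(-p) replaced by 1 and H p
   left out when -p is not in Sigma_2. This fails only if H p = p, H q = q,
   p + q = 0 or p + H q = 0, which confines y to two circles and a line. *)
Require Import Defs.
From mathcomp Require Import all_boot all_order all_algebra.
From mathcomp Require Import complex.
From mathcomp Require Import all_classical all_reals all_analysis.
From mathcomp Require Import measurable_realfun.
From mathcomp Require Import ring lra.

Set Implicit Arguments.
Unset Strict Implicit.
Unset Printing Implicit Defensive.

Import Order.TTheory GRing.Theory Num.Theory.
Import numFieldNormedType.Exports.

Local Open Scope classical_set_scope.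
Local Open Scope ring_scope.

(** * Sums of two points of a circle *)

Lemma circleE (R : realType) (k0 : R) (x : R * R) :
  0 < k0 -> circle k0 x <-> dot x x = k0 ^+ 2.
Proof.
move=> k0_gt0; rewrite /circle /= /enorm; split=> [<-|->].
  by rewrite sqr_sqrtr// /dot addr_ge0// -expr2 sqr_ge0.
by rewrite sqrtr_sqr gtr0_norm.
Qed.

Lemma dot_eq0 (R : realType) (x : R * R) : dot x x = 0 -> x = 0.
Proof.
case: x => x1 x2 /eqP; rewrite /dot /= -!expr2 paddr_eq0 ?sqr_ge0// !sqrf_eq0.
by move=> /andP[/eqP-> /eqP->].
Qed.

Lemma dotNl (R : realType) (x y : R * R) : dot (- x) y = - dot x y.
Proof. by rewrite /dot /=; ring. Qed.

Lemma dotNr (R : realType) (x y : R * R) : dot x (- y) = - dot x y.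
Proof. by rewrite /dot /=; ring. Qed.

(** In the plane, vectors orthogonal to a common nonzero [z] have zero cross product, and |u|^2
    |v|^2 is the sum of the squares of the dot and cross products. *)
Lemma dot_orthogonal (R : realType) (u v z : R * R) : z != 0 ->
  dot u z = 0 -> dot v z = 0 -> dot u v = 0 -> u = 0 \/ v = 0.
Proof.
case: u v z => [u1 u2] [v1 v2] [z1 z2]; rewrite /dot /= => z0 uz vz uv.
have cross0 : u1 * v2 - u2 * v1 = 0.
  apply/eqP; apply: contraNT z0 => c0.
  have z1c : z1 * (u1 * v2 - u2 * v1) = 0.
    transitivity (v2 * (u1 * z1 + u2 * z2) - u2 * (v1 * z1 + v2 * z2)).
      by ring.
    by rewrite uz vz; ring.
  have z2c : z2 * (u1 * v2 - u2 * v1) = 0.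
    transitivity (u1 * (v1 * z1 + v2 * z2) - v1 * (u1 * z1 + u2 * z2)).
      by ring.
    by rewrite uz vz; ring.
  move/eqP: z1c; rewrite mulf_eq0 (negbTE c0) orbF => /eqP->.
  by move/eqP: z2c; rewrite mulf_eq0 (negbTE c0) orbF => /eqP->.
have : dot (u1, u2) (u1, u2) * dot (v1, v2) (v1, v2) = 0.
  transitivity ((u1 * v1 + u2 * v2) ^+ 2 + (u1 * v2 - u2 * v1) ^+ 2).
    by rewrite /dot /=; ring.
  by rewrite uv cross0; ring.
by move=> /eqP; rewrite mulf_eq0 => /orP[] /eqP/dot_eq0; [left|right].
Qed.

(* [s - p], [s - q] and [p + q] are pairwise orthogonal, so one of them is 0. *)
Lemma circle_sum_inj (R : realType) (k0 : R) (p q s t : R * R) : 0 < k0 ->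
  circle k0 p -> circle k0 q -> circle k0 s -> circle k0 t ->
  p + q = s + t -> p + q != 0 -> (s = p /\ t = q) \/ (s = q /\ t = p).
Proof.
move=> k0_gt0 /(circleE _ k0_gt0) cp /(circleE _ k0_gt0) cq.
move=> /(circleE _ k0_gt0) cs /(circleE _ k0_gt0) ct pqst pq0.
have tE : t = p + q - s by rewrite pqst addrC addKr.
have [sp|sq] : s - p = 0 \/ s - q = 0.
  apply: (dot_orthogonal pq0); move: cp cq cs ct; rewrite tE;
    case: p q s {pqst pq0 tE} => [p1 p2] [q1 q2] [s1 s2]; rewrite /dot /=; lra.
- by left; rewrite tE (subr0_eq sp) [p + q]addrC addrK.
- by right; rewrite tE (subr0_eq sq) addrK.
Qed.

(** A nonzero sum determines the unordered pair, but all opposite pairs sum to 0; hence the symmetry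
    of [G] and the common value [x0]. This makes a solution on pairs a function on the plane. *)
Lemma circle_sum_fun (R : realType) (k0 : R) (T : Type) (x0 : T)
    (G : R * R -> R * R -> T) : 0 < k0 ->
  (forall s t, G s t = G t s) -> (forall s, G s (- s) = x0) ->
  exists g : R * R -> T,
    forall s t, circle k0 s -> circle k0 t -> g (s + t) = G s t.
Proof.
move=> k0_gt0 Gsym Gopp.
pose D (z : R * R) : set ((R * R) * (R * R)) :=
  [set st | [/\ circle k0 st.1, circle k0 st.2 & st.1 + st.2 = z]].
exists (fun z => let st := xget (0, 0) (D z) in G st.1 st.2) => s t cs ct.
have : D (s + t) (xget (0, 0) (D (s + t))) by apply: (@xgetPex _ (0, 0)); exists (s, t).
case: xget => s' t' /= [/= cs' ct' sum].
have [z0|z0] := eqVneq (s + t) 0.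
  have -> : t = - s by apply/eqP; rewrite -addr_eq0 addrC z0.
  have -> : t' = - s' by apply/eqP; rewrite -addr_eq0 addrC sum z0.
  by rewrite !Gopp.
by have [[-> ->]|[-> ->]] := circle_sum_inj k0_gt0 cs ct cs' ct' (esym sum) z0.
Qed.

(** * The mirror and the exceptional curves *)

Lemma circleN (R : realType) (k0 : R) (x : R * R) :
  circle k0 x -> circle k0 (- x).
Proof. by rewrite /circle /= /enorm dotNl dotNr opprK. Qed.

Lemma mirrorN (R : realType) (nu x : R * R) : mirror nu (- x) = - mirror nu x.
Proof. by rewrite /mirror dotNl mulrN scaleNr opprB opprK addrC. Qed.

Lemma dot_unit (R : realType) (nu : R * R) : enorm nu = 1 -> dot nu nu = 1.
Proof. by move/(circleE _ ltr01) => ->; rewrite expr1n. Qed.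

Lemma mirrorE (R : realType) (nu x : R * R) : mirror nu x =
  (x.1 - 2 * dot x nu * nu.1, x.2 - 2 * dot x nu * nu.2).
Proof. by []. Qed.

Lemma mirrorK (R : realType) (nu x : R * R) : enorm nu = 1 ->
  mirror nu (mirror nu x) = x.
Proof.
move=> /dot_unit nu1; rewrite /mirror.
have -> : dot (x - (2 * dot x nu) *: nu) nu =
          dot x nu - 2 * dot x nu * dot nu nu.
  by rewrite -/(mirror nu x) mirrorE /dot /=; ring.
rewrite nu1; set d := dot x nu.
rewrite -addrA -opprD -scalerDl.
have -> : 2 * d + 2 * (d - 2 * d * 1) = 0 by ring.
by rewrite scale0r subr0.
Qed.

Lemma circle_mirror (R : realType) (k0 : R) (nu x : R * R) : enorm nu = 1 ->
  circle k0 x -> circle k0 (mirror nu x).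
Proof.
move=> /dot_unit nu1; rewrite /circle /= /enorm => <-; congr Num.sqrt.
transitivity (dot x x + 4 * dot x nu ^+ 2 * (dot nu nu - 1)).
  by rewrite mirrorE /dot /=; ring.
by rewrite nu1 subrr mulr0 addr0.
Qed.

Lemma Sigma2_mirror (R : realType) (k0 : R) (nu omega s : R * R) :
  enorm nu = 1 ->
  Sigma2 k0 nu omega s -> Sigma2 k0 nu omega (mirror nu s).
Proof. by move=> nu1 [s1 s2]; split => //; rewrite mirrorK. Qed.

Definition perp (R : realType) (v : R * R) : R * R := (- v.2, v.1).

(* A fixed point of the mirror on the circle is [k0] or [- k0] times [perp nu]. *)
Lemma mirror_fix_conic (R : realType) (k0 : R) (nu p q : R * R) :
  0 < k0 -> enorm nu = 1 -> circle k0 p -> circle k0 q -> mirror nu p = p ->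
  dot (p + q) (p + q) + dot (p + q) ((2 * k0) *: perp nu) = 0 \/
  dot (p + q) (p + q) + dot (p + q) ((- (2 * k0)) *: perp nu) = 0.
Proof.
move=> k0_gt0 /dot_unit nu1 /(circleE _ k0_gt0) cp /(circleE _ k0_gt0) cq pH.
have pnu : dot p nu = 0.
  have : dot (mirror nu p) nu = dot p nu by rewrite pH.
  have -> : dot (mirror nu p) nu = dot p nu - 2 * dot p nu * dot nu nu.
    by rewrite mirrorE /dot /=; ring.
  by rewrite nu1; lra.
have [l pE] : exists l, p = l *: perp nu.
  exists (dot p (perp nu)).
  rewrite [LHS]surjective_pairing; congr pair; rewrite /= /GRing.scale/=.
    transitivity (p.1 * dot nu nu - nu.1 * dot p nu).
      by rewrite nu1 pnu; ring.
    by rewrite /dot /=; ring.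
  transitivity (p.2 * dot nu nu - nu.2 * dot p nu).
    by rewrite nu1 pnu; ring.
  by rewrite /dot /=; ring.
have l2 : l ^+ 2 = k0 ^+ 2.
  by rewrite -cp pE -[LHS]mulr1 -nu1 /dot /= /GRing.scale/=; ring.
(* As |p| = |q|, |p + q|^2 is twice the product of [p] and [p + q]. *)
have conic : dot (p + q) (p + q) = 2 * l * dot (p + q) (perp nu).
  have -> : 2 * l * dot (p + q) (perp nu) = 2 * dot (p + q) (l *: perp nu).
    by rewrite /dot /= /GRing.scale/=; ring.
  by rewrite -pE; move: cp cq; rewrite /dot /=; lra.
move/eqP: l2; rewrite eqf_sqr => /orP[] /eqP lE; [right|left];
  rewrite conic lE /dot /= /GRing.scale/=; ring.
Qed.

(** The difference is a multiple of [nu]; it equals [p + q] when [p] is opposite to the mirror image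
    of [q]. *)
Lemma mirror_opp_line (R : realType) (nu q : R * R) :
  dot (q - mirror nu q) (perp nu) = 0.
Proof. by rewrite mirrorE /dot /=; ring. Qed.

Lemma perp_neq0 (R : realType) (nu : R * R) : enorm nu = 1 -> perp nu != 0.
Proof.
move=> /dot_unit nu1; apply/eqP => -[n2 n1].
by move: nu1; rewrite /dot n1 -[nu.2]opprK n2; lra.
Qed.

(** * Null sets in the plane *)

Lemma countable_quadratic_roots (R : realType) (a b c : R) :
  (a != 0) || (b != 0) -> countable [set t | a * t ^+ 2 + b * t + c = 0].
Proof.
move=> ab; apply: finite_set_countable.
have [a0|a0] := eqVneq a 0.
  rewrite a0 eqxx /= in ab.
  apply: (sub_finite_set (B := [set - c / b])) => //= t /=.
  rewrite a0 mul0r add0r => /eqP; rewrite addr_eq0 => /eqP btc.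
  by rewrite /= -btc mulrC mulKf.
have [[r r0]|] := pselect (exists r, a * r ^+ 2 + b * r + c = 0); last first.
  by move=> nr; apply: (sub_finite_set (B := set0)) => // t rt; apply: nr; exists t.
apply: (sub_finite_set (B := [set r; - b / a - r])) => //= t /= t0.
(* The difference of the equations at [t] and at the known root [r] factors. *)
have : (t - r) * (a * (t + r) + b) = 0 by move: t0 r0; lra.
move=> /eqP; rewrite mulf_eq0 subr_eq0 => /orP[/eqP->|]; first by left.
rewrite addr_eq0 => /eqP /(canRL (mulKf a0)) tr.
by right; rewrite -[t](addrK r) tr /=; field.
Qed.

(** Sections at a fixed first coordinate are root sets of a polynomial, hence null. Only a vertical
    line escapes this argument; it is the product of a null set and the line. *)
Lemma ae_conic (R : realType) (a : R) (w : R * R) :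
  (a != 0) || (w != 0) ->
  {ae lebesgue_plane R, forall y : R * R, a * dot y y + dot y w != 0}.
Proof.
move=> aw.
pose f (y : measurableTypeR R * measurableTypeR R) : measurableTypeR R :=
  a * dot y y + dot y w.
have mf : measurable_fun setT f.
  rewrite /f /dot; apply: measurable_funD; first apply: measurable_funM => //.
    by apply: measurable_funD; apply: measurable_funM.
  by apply: measurable_funD; apply: measurable_funM.
have mA : measurable (f @^-1` [set 0]).
  by rewrite -[X in measurable X]setTI; apply: mf => //; exact: measurable_set1.
exists (f @^-1` [set 0]); split => //; last first.
  by move=> y /= /negP; rewrite negbK => /eqP.
have [aw2|] := boolP ((a != 0) || (w.2 != 0)).
  rewrite /lebesgue_plane /= /product_measure1 integral0_eq// => x _ /=.
  apply: countable_lebesgue_measure0.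
  have -> : xsection (f @^-1` [set 0]) x =
      [set t | a * t ^+ 2 + w.2 * t + (a * x ^+ 2 + w.1 * x) = 0].
    apply/seteqP; split => t; rewrite /xsection /= inE /f /dot /= => <-; ring.
  exact: countable_quadratic_roots.
rewrite negb_or !negbK => /andP[/eqP a0 /eqP w20].
have w10 : w.1 != 0.
  move: aw; rewrite a0 eqxx /=; apply: contra => /eqP w10.
  by rewrite (surjective_pairing w) w10 w20.
have -> : f @^-1` [set 0] = [set 0] `*` [set: R].
  apply/seteqP; split => y; rewrite /f /dot /= a0 w20 mul0r mulr0 add0r addr0.
    by move=> /eqP; rewrite mulf_eq0 (negbTE w10) orbF => /eqP.
  by move=> [-> _]; rewrite mul0r.
rewrite /lebesgue_plane /= product_measure1E//.
by have /= -> := lebesgue_measure_set1 (0 : R); rewrite mul0e.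
Qed.

(* The alternating wave started at [p]; it moves to the mirror image of [p]
   only when the equations couple the two points, i.e. when [V p]. *)
Definition wave (R : realType) (H : R * R -> R * R) (V : set (R * R))
    (A : R * R -> R[i]) (p s : R * R) : R[i] :=
  if s == p then (if `[< V p >] then (A p)^-1 else 1)
  else if `[< V p >] && (s == H p) then - (A (H p))^-1 else 0.

(** * Alternating waves and their symmetrized products *)

Section Wave.
Variables (R : realType) (H : R * R -> R * R) (V : set (R * R)).
Variable A : R * R -> R[i].
Hypothesis HK : involutive H.
Hypothesis VH : forall s, V s -> V (H s).
Hypothesis A0 : forall s, V s -> A s != 0.
Local Notation wave := (wave H V A).

Lemma wave_supp p s : wave p s != 0 -> s = p \/ V p /\ s = H p.
Proof.
rewrite /wave; case: (eqVneq s p) => [->|_]; first by left.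
case: asboolP => //= [Vp|]; last by rewrite eqxx.
by case: (eqVneq s (H p)) => [->|_]; [right|rewrite eqxx].
Qed.

Lemma wave_self p : wave p p != 0.
Proof.
by rewrite /wave eqxx; case: asboolP => [/A0|_]; rewrite ?invr_eq0// oner_eq0.
Qed.

(** If [t] is [p] or [H p], then [V p] holds and the terms are 1 and -1 in some order; [H p <> p]
    keeps the two values of the wave apart. Otherwise both terms vanish. *)
Lemma wave_eq p t : H p <> p -> V t ->
  A t * wave p t + A (H t) * wave p (H t) = 0.
Proof.
move=> /eqP Hp Vt; have VHt := VH Vt.
have [tp|tp] := eqVneq t p.
  rewrite -{}tp in Hp *; rewrite /wave (negbTE Hp) !eqxx asboolT//=.
  by rewrite mulrN !mulfV ?A0// subrr.
have [tHp|tHp] := eqVneq t (H p).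
  rewrite {}tHp in Vt VHt tp *; rewrite HK in VHt *.
  rewrite /wave (negbTE tp) !eqxx asboolT//=.
  by rewrite mulrN !mulfV ?A0// addrC subrr.
rewrite /wave (negbTE tp) (negbTE tHp) andbF mulr0 add0r.
have -> : (H t == p) = false.
  by apply/eqP => Htp; move: tHp; rewrite -Htp HK eqxx.
have -> : (H t == H p) = false.
  by apply/eqP => /(can_inj HK) /eqP; rewrite (negbTE tp).
by rewrite andbF mulr0.
Qed.

(** Symmetrized, so that it depends only on the unordered pair of [s] and [t]. *)
Definition pair_wave p q s t := wave p s * wave q t + wave p t * wave q s.

Lemma pair_waveC p q s t : pair_wave p q s t = pair_wave p q t s.
Proof. by rewrite /pair_wave addrC. Qed.

Lemma pair_wave_supp p q s t : pair_wave p q s t != 0 ->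
  wave p s != 0 /\ wave q t != 0 \/ wave p t != 0 /\ wave q s != 0.
Proof.
rewrite /pair_wave => pw.
have [|] := boolP (wave p s * wave q t == 0); last first.
  by rewrite mulf_eq0 negb_or => /andP[]; left.
by move=> /eqP e; move: pw; rewrite e add0r mulf_eq0 negb_or => /andP[]; right.
Qed.

(** The two terms cannot cancel: the second one is 0 unless [q = p] or [q = H p], and then it equals
    the first. *)
Lemma pair_wave_self p q : H p <> p -> pair_wave p q p q != 0.
Proof.
move=> /eqP Hp; have pq0 : wave p p * wave q q != 0.
  by rewrite mulf_neq0 ?wave_self.
suff : wave p q * wave q p = 0 \/ wave p q * wave q p = wave p p * wave q q.
  by rewrite /pair_wave => -[]->; rewrite ?addr0// -mulr2n mulrn_eq0.
have [->|qp] := eqVneq p q; first by right.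
have [|/wave_supp[e|[Vp qHp]]] := eqVneq (wave p q) 0.
- by move=> ->; left; rewrite mul0r.
- by rewrite e eqxx in qp.
right; rewrite {}qHp /wave HK !eqxx (negbTE Hp) eq_sym (negbTE Hp).
by rewrite !asboolT//=; [rewrite mulrNN mulrC|exact: VH].
Qed.

Lemma pair_wave_eq p q s t : H p <> p -> H q <> q -> V t ->
  A t * pair_wave p q s t + A (H t) * pair_wave p q s (H t) = 0.
Proof.
move=> Hp Hq Vt; rewrite /pair_wave.
transitivity (wave p s * (A t * wave q t + A (H t) * wave q (H t)) +
              wave q s * (A t * wave p t + A (H t) * wave p (H t))).
  by ring.
by rewrite !wave_eq// !mulr0 addr0.
Qed.

End Wave.

(** * Vanishing and nonvanishing of solutions of (HS) *)

Theorem theorem6p5 (R : realType) (k0 : R) (nu omega : R * R) (chi : R)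
    (a b : R * R -> R[i])
    (k0_gt0 : 0 < k0) (nu_unit : enorm nu = 1) (omega_unit : enorm omega = 1)
    (chi01 : 0 < chi < 1)
    (a_sqint : square_integrable_circle k0 a)
    (a_supp : forall s : R * R, circle k0 s -> (a s <> 0 <-> 0 < dot s omega))
    (b_def : is_ratio k0 chi nu omega a b) :
  (forall g : R * R -> R[i], solves_HS k0 nu omega b g ->
     {ae lebesgue_plane R, forall y : R * R,
       (Y1 k0 nu omega `|` Ytilde k0 nu omega) y -> g y = 0}) /\
  {ae lebesgue_plane R, forall y : R * R,
     (Y2 k0 nu omega `\` (Y1 k0 nu omega `|` Ytilde k0 nu omega)) y ->
     exists g : R * R -> R[i], solves_HS k0 nu omega b g /\ g y <> 0}.
Proof.
split=> [g gHS|].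
  apply: aeW => _ [[eta eU [s s1 <-]]|[eta [[s' s'1 <-] eU] [s [[s2 [cs se2]] _] <-]]].
    by have [+ _] := gHS _ eU; exact.
  (* With [eta = - s'], the point [eta - s] is also [- s - s'], which lies in [Y1] because [- s] is
     in the upper half circle. *)
  have negsU : halfcircle k0 (e2 R) (- s).
    by split; [exact: circleN|move: se2; rewrite dotNl dotNr].
  have [_ /(_ _ s2)] := gHS _ eU.
  have [/(_ _ s'1) + _] := gHS _ negsU.
  by rewrite [- s - s']addrC => ->; rewrite mulr0 add0r.
(* The two circles collect the cases [H p = p] and [H q = q], the line the cases [p + q = 0] and
   [p + H q = 0]. *)
have c1 : ((1 : R) != 0) || ((2 * k0) *: perp nu != 0) by rewrite oner_eq0.
have c2 : ((1 : R) != 0) || ((- (2 * k0)) *: perp nu != 0) by rewrite oner_eq0.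
have c3 : ((0 : R) != 0) || (perp nu != 0) by rewrite perp_neq0 ?orbT.
have aeF := ae_filter_ringOfSetsType (lebesgue_plane R).
apply: (@filterS3 _ _ aeF _ _ _ _ _ (ae_conic c1) (ae_conic c2) (ae_conic c3)) => y.
rewrite !mul1r mul0r add0r => y1 y2 y3 [[p pU [r r2 yE]] /not_orP[yY1 yYt]].
(* The sign change turns the differences of (HS) into sums; [V] and [A] are [Sigma2] and [a] read at
   the opposite point. *)
pose q := - r; have qE : p + q = y by rewrite -yE.
pose H := mirror nu; pose V : set (R * R) := [set t | Sigma2 k0 nu omega (- t)].
pose A (t : R * R) := a (- t).
have HK : involutive H by move=> x; exact: mirrorK.
have VH t : V t -> V (H t).
  by rewrite /V /= -mirrorN; exact: Sigma2_mirror.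
have A0 t : V t -> A t != 0.
  by move=> [[ct to] _]; apply/eqP/a_supp.
have Vq : V q by rewrite /V /q /= opprK.
have cp : circle k0 p by case: pU.
have cq : circle k0 q by case: r2 => -[cr _] _; exact: circleN.
have Hp : H p <> p.
  move=> /(mirror_fix_conic k0_gt0 nu_unit cp cq); rewrite qE.
  by move=> -[/eqP|/eqP]; apply/negP.
have Hq : H q <> q.
  move=> /(mirror_fix_conic k0_gt0 nu_unit cq cp); rewrite [q + p]addrC qE.
  by move=> -[/eqP|/eqP]; apply/negP.
have pq0 : p + q != 0.
  by rewrite qE; apply: contraNneq y3 => ->; rewrite /dot /= !mul0r addr0.
have pHq0 : p + H q != 0.
  apply: contraNneq y3 => /eqP; rewrite addr_eq0 -qE => /eqP->.
  by rewrite addrC mirror_opp_line.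
pose W := pair_wave H V A p q.
(* A nonzero value would make one of [p], [H p] opposite to one of [q], [H q]; applying [H] leaves
   only the two excluded sums. *)
have Wopp t : W t (- t) = 0.
  apply/eqP/negPn/negP => /pair_wave_supp.
  wlog : t / wave H V A p t != 0 /\ wave H V A q (- t) != 0.
    move=> wl [|[w1 w2]]; first by move=> ww; exact: (wl t ww (or_introl ww)).
    by apply: (wl (- t)); rewrite ?opprK; [split|left; split].
  move=> [/wave_supp tp /wave_supp tq] _.
  case: tp tq => [->|[Vp ->]] [|[_]] e.
  - by move: pq0; rewrite -e subrr eqxx.
  - by move: pHq0; rewrite -e subrr eqxx.
  - by move: pHq0; rewrite -e /H mirrorN mirrorK// subrr eqxx.
  - move: e; rewrite /H -mirrorN => /(can_inj HK) e.
    by move: pq0; rewrite -e subrr eqxx.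
have [g gW] := circle_sum_fun k0_gt0 (pair_waveC H V A p q) Wopp.
exists g; split; last first.
  by rewrite -qE gW//; apply/eqP/pair_wave_self.
move=> eta eU; have ceta : circle k0 eta by case: eU.
split=> s sS; have cs : circle k0 (- s) by case: sS => -[/circleN].
  rewrite gW//; apply/eqP/negPn/negP => /pair_wave_supp.
  have nVs : ~ V (- s) by rewrite /V /= opprK => -[_]; case: sS.
  move=> [[_ /wave_supp[sq|[_ sq]]]|[/wave_supp + /wave_supp]].
  - by apply: nVs; rewrite sq.
  - by apply: nVs; rewrite sq; exact: VH.
  move=> [sp|[Vp sp]]; last by move=> _; apply: nVs; rewrite sp; exact: VH.
  (* Here [- s = p], and [eta] is [q] or [H q]. The first is ruled out by [Y1]. *)
  have notqU : ~ halfcircle k0 (e2 R) q.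
    by move=> qU; apply: yY1; exists q => //; exists s => //; rewrite -qE -sp addrC.
  move=> [eq|[_ eq]]; first by apply: notqU; rewrite -eq.
  have HqE : H q = - mirror nu r by rewrite /H /q mirrorN.
  (* Now [eta = H q] is in the upper half circle and [q] is not, so [mirror nu r] witnesses
     membership of [y] in [Ytilde]. *)
  apply: yYt; exists p; first by split => //; exists s.
  exists (mirror nu r); last by rewrite mirrorK.
  split; first split; first exact: Sigma2_mirror.
    move: eU; rewrite eq HqE => -[/circleN]; rewrite opprK dotNl => cr re2.
    by split=> //; rewrite dotNr.
  rewrite /= mirrorK// => -[cr re2]; apply: notqU.
  by split; [exact: circleN|move: re2; rewrite dotNl dotNr].
have Vs : V (- s) by rewrite /V /= opprK.
have bs : b s = A (- s) / A (H (- s)).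
  rewrite /A /H mirrorN !opprK -(scale1r s) (b_def.2 1) ?scale1r//.
  by case/andP: chi01 => chi_gt0 chi_lt1; rewrite gtrBl chi_gt0 ltrDl chi_gt0.
have cHs : circle k0 (H (- s)) by exact: circle_mirror.
have AHs0 := A0 _ (VH _ Vs).
(* Multiplying by [A (H (- s))] clears the denominator of [b s]. *)
rewrite -(mirrorN nu s) !gW// bs; apply: (mulfI AHs0).
rewrite mulr0 mulrDr mulrA mulrCA mulfV// mulr1.
exact: pair_wave_eq.
Qed.
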